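(* Let $k\ge 1$ be an integer and let $G$ be a graph on $n \geq 2(k-1) + 2^{2(k-1)} + 1$ vertices. Then $G$ has an induced subgraph $H$ with $2k$ vertices that is (isomorphic to) a letter graph $\Gamma_D(w)$ on the word $$w = \ell_1\, \ell_2 \cdots \ell_k\, \ell_k \cdots \ell_2\, \ell_1$$ of length $2k$ over the $k$-letter alphabet $\{\ell_1,\dots,\ell_k\}$, for some decoder $D\subseteq\{\ell_1,\dots,\ell_k\}^2$. Thus, $\ell(G) \leq n - k$.
   Context: All graphs are finite and simple. Given a finite alphabet $\Sigma$, a decoder is a set of ordered pairs $D\subseteq\Sigma^2$. For a word $w$ with letters $w(1),\dots,w(n)\in\Sigma$, the letter graph $\Gamma_D(w)$ is the graph with vertex set $\{1,\dots,n\}$ and with an edge $ij$ for each $i<j$ such that $(w(i),w(j))\in D$. If $|\Sigma|=k$, then $\Gamma_D(w)$ is called a $k$-letter graph. The lettericity $\ell(G)$ of a graph $G$ is the least integer $k$ such that $G$ is isomorphic to a $k$-letter graph. *)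

(* Defs.v *)
From mathcomp Require Import all_boot.
From mathcomp Require Import boolp.

Set Implicit Arguments.
Unset Strict Implicit.
Unset Printing Implicit Defensive.

Record sgraph := SGraph {
  vertex :> finType;
  edge : rel vertex;
  edge_sym : symmetric edge;
  edge_irr : irreflexive edge }.

Definition isomorphic (G H : sgraph) : Prop :=
  exists2 f : G -> H, bijective f & forall x y, edge (f x) (f y) = edge x y.

Section Induced.
Variables (G : sgraph) (S : {set G}).

Definition induced_edge : rel {x : G | x \in S} :=
  fun x y => edge (val x) (val y).

Lemma induced_sym : symmetric induced_edge.
Proof. by move=> x y; rewrite /induced_edge edge_sym. Qed.

Lemma induced_irr : irreflexive induced_edge.
Proof. by move=> x; rewrite /induced_edge edge_irr. Qed.

Definition induced : sgraph := SGraph induced_sym induced_irr.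

End Induced.

(* Positions in words are numbered from 0. *)
Section LetterGraph.
Variables (Sigma : finType) (D : {set Sigma * Sigma}) (w : seq Sigma).

Definition letter (i : 'I_(size w)) : Sigma := tnth (in_tuple w) i.

Definition letter_edge : rel 'I_(size w) := fun i j =>
  ((i < j) && ((letter i, letter j) \in D))
  || ((j < i) && ((letter j, letter i) \in D)).

Lemma letter_sym : symmetric letter_edge.
Proof. by move=> i j; rewrite /letter_edge orbC. Qed.

Lemma letter_irr : irreflexive letter_edge.
Proof. by move=> i; rewrite /letter_edge ltnn. Qed.

Definition letter_graph : sgraph := SGraph letter_sym letter_irr.

End LetterGraph.

(* [w] need not use every letter of [Sigma]. *)
Definition k_letter (k : nat) (G : sgraph) : Prop :=
  exists (Sigma : finType) (D : {set Sigma * Sigma}) (w : seq Sigma),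
    #|Sigma| = k /\ isomorphic G (letter_graph D w).

Lemma k_letter_card (G : sgraph) : k_letter #|G| G.
Proof.
pose D := [set p : G * G | edge p.1 p.2].
exists G, D, (enum G); split=> //.
have szE : size (enum G) = #|G| by rewrite -cardE.
have ltP (x : G) : index x (enum G) < size (enum G).
  by rewrite index_mem mem_enum.
have letterK (x : G) : letter (Ordinal (ltP x)) = x.
  by rewrite /letter (tnth_nth x) /= nth_index ?mem_enum.
exists (fun x : G => Ordinal (ltP x)).
  exists (@letter G (enum G)) => // i; apply: val_inj => /=.
  have x0 := letter i.
  by rewrite /letter (tnth_nth x0) /= index_uniq ?enum_uniq.
move=> x y; rewrite /edge /= /letter_edge !letterK !inE /= -/(edge _ _).
rewrite (edge_sym y x) -andb_orl.
case: ltngtP => //= eqi.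
suff -> : x = y by rewrite edge_irr.
by rewrite -(letterK x) -(letterK y); congr letter; apply: val_inj.
Qed.

Lemma ex_k_letter (G : sgraph) : exists k, `[< k_letter k G >].
Proof. by exists #|G|; apply/asboolP/k_letter_card. Qed.

Definition lettericity (G : sgraph) : nat := ex_minn (ex_k_letter G).

(* The word l_1 l_2 ... l_k l_k ... l_2 l_1, with l_(i+1) encoded as i : 'I_k. *)
Definition nested_word (k : nat) : seq 'I_k := enum 'I_k ++ rev (enum 'I_k).

(* Main.v *)
Require Import Defs.
From mathcomp Require Import all_boot.
From mathcomp Require Import zify boolp.

(** Adjacency to a set [X] splits the vertices outside [X] into at most
    [2 ^ #|X|] classes, so pigeonhole yields two vertices that [X] does not
    distinguish. Choosing such pairs [(u_0, v_0), (u_1, v_1), ...] greedily,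
    each one undistinguished by the previous ones, and writing them in the order
    [u_0 u_1 ... v_1 v_0] gives a letter graph in which [u_i] and [v_i] share a
    letter. The remaining vertices, each with a private letter, can be inserted
    in the middle of the word: such a vertex [x] has [u_i] on its left and [v_i]
    on its right, so its adjacencies to the two are coded by the distinct pairs
    [(u_i, x)] and [(x, u_i)]. *)

Set Implicit Arguments.
Unset Strict Implicit.
Unset Printing Implicit Defensive.

Lemma isomorphic_trans (G H K : sgraph) :
  isomorphic G H -> isomorphic H K -> isomorphic G K.
Proof.
move=> [f bij_f edge_f] [g bij_g edge_g].
by exists (g \o f) => [|x y]; [apply: bij_comp | rewrite /= edge_g edge_f].
Qed.

Lemma isomorphic_inducedT (G : sgraph) (S : {set G}) :
  (forall x, x \in S) -> isomorphic G (induced S).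
Proof.
move=> S_full.
by exists (fun x => exist _ x (S_full x)) => //; exists val => // x; apply: val_inj.
Qed.

(** Each vertex goes to its index in [s]. Since [edge] is symmetric, the decoder only has to be
    checked on pairs of positions in increasing order. *)
Lemma isomorphic_letter_graph (G : sgraph) (x0 : G) (Sigma : finType) (a0 : Sigma)
    (D : {set Sigma * Sigma}) (w : seq Sigma) (s : seq G) :
    uniq s -> size s = size w ->
    (forall p q, p < q < size s ->
       edge (nth x0 s p) (nth x0 s q) = ((nth a0 w p, nth a0 w q) \in D)) ->
  isomorphic (induced [set x in s]) (letter_graph D w).
Proof.
move=> s_uniq sz_sw s_edge.
have mem_s (x : induced [set x in s]) : val x \in s by have := valP x; rewrite inE.
have index_lt (x : induced [set x in s]) : index (val x) s < size w.
  by rewrite -sz_sw index_mem.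
have nth_in (i : 'I_(size w)) : nth x0 s i \in [set x in s].
  by rewrite inE mem_nth // sz_sw.
exists (fun x => Ordinal (index_lt x)).
  exists (fun i : 'I_(size w) => exist _ (nth x0 s i) (nth_in i)) => [x|i].
    by apply: val_inj; rewrite /= nth_index ?mem_s.
  by apply: val_inj; rewrite /= index_uniq // sz_sw.
move=> x y; rewrite [LHS]/edge /= /letter_edge /letter !(tnth_nth a0) /=.
have edgeE (z t : induced [set x in s]) : index (val z) s < index (val t) s ->
    edge z t = ((nth a0 w (index (val z) s), nth a0 w (index (val t) s)) \in D).
  by move=> lt_zt; rewrite -s_edge ?lt_zt ?sz_sw ?index_lt // !nth_index.
case: ltngtP => [lt_xy|lt_yx|eq_xy] /=.
- by rewrite orbF -edgeE.
- by rewrite -edgeE // edge_sym.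
suff -> : x = y by rewrite induced_irr.
exact/val_inj/(index_inj x0 (mem_s x) (mem_s y) eq_xy).
Qed.

Lemma ex_undistinguished_pair (G : sgraph) (X : {set G}) :
    2 ^ #|X| < #|~: X| ->
  exists a b : G, [/\ a \notin X, b \notin X, a != b &
    {in X, forall x, edge x a = edge x b}].
Proof.
rewrite -card_powerset => lt_card.
pose nbhd a := [set x in X | edge x a].
have /dinjectivePn[a aX [b]] : ~~ dinjectiveb nbhd (mem (~: X)).
  apply: contraL lt_card => /dinjectiveP nbhd_inj.
  rewrite -leqNgt -(card_in_imset nbhd_inj); apply/subset_leq_card/subsetP => A.
  by case/imsetP=> a _ ->; rewrite powersetE; apply/subsetP => x /setIdP[].
rewrite !inE in aX *; case/andP=> ba bX /setP eq_nbhd.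
exists a, b; split; rewrite 1?eq_sym // => x xX.
by have := eq_nbhd x; rewrite !inE xX.
Qed.

Lemma ex_undistinguished_pairs (G : sgraph) (x0 : G) (k : nat) :
    2 * (k - 1) + 2 ^ (2 * (k - 1)) + 1 <= #|G| ->
  exists u v : seq G, [/\ size u = k, size v = k, uniq (u ++ v) &
    forall i j, i < j < k ->
      edge (nth x0 u i) (nth x0 u j) = edge (nth x0 u i) (nth x0 v j)
      /\ edge (nth x0 v i) (nth x0 u j) = edge (nth x0 v i) (nth x0 v j)].
Proof.
elim: k => [|k IHk] leG; first by exists [::], [::]; split.
rewrite subn1 /= in leG.
have [|u [v [sz_u sz_v uv_uniq uv_edge]]] := IHk.
  by apply: leq_trans leG; rewrite leq_add2r leq_add ?leq_exp2l ?leq_mul2l ?leq_subr.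
pose X := [set x in u ++ v].
have cardX : #|X| = 2 * k.
  by rewrite cardsE (card_uniqP uv_uniq) size_cat sz_u sz_v; lia.
have [|a [b [aX bX ab ab_edge]]] := @ex_undistinguished_pair G X.
  (* This is where the bound on [#|G|] comes from: removing the [2 * k] vertices of [X] must leave
     more than [2 ^ (2 * k)] of them. *)
  by rewrite -(ltn_add2l #|X|) cardsC cardX -addn1.
exists (rcons u a), (rcons v b).
rewrite !size_rcons sz_u sz_v; split=> // [|i j /andP[lt_ij]].
  rewrite cat_rcons -cats1 -cat_cons catA cats1 rcons_uniq -cat1s uniq_catCA /=.
  move: aX bX; rewrite !inE !mem_cat !inE !negb_or uv_uniq eq_sym ab /=.
  by move=> /andP[-> ->] /andP[-> ->].
(* If [j = k], the later pair is [(a, b)], which no vertex of [X] distinguishes; otherwise both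
   pairs are old. *)
rewrite ltnS leq_eqVlt !nth_rcons sz_u sz_v => /predU1P[eq_jk|lt_jk].
  rewrite eq_jk ltnn eqxx -eq_jk lt_ij.
  by split; apply: ab_edge; rewrite inE mem_cat mem_nth ?orbT // ?sz_u ?sz_v -eq_jk.
by rewrite lt_jk (ltn_trans lt_ij lt_jk); apply: uv_edge; rewrite lt_ij.
Qed.

(** The first [k] letters occur twice, nested around the other [m - k], which occur once. The case
    [m = k] is the nested word; [m = #|G| - k] will encode all of [G]. *)
Definition half_nested_word (m k : nat) : seq 'I_m :=
  enum 'I_m ++ rev (take k (enum 'I_m)).

Lemma half_nested_word_diag (k : nat) : half_nested_word k k = nested_word k.
Proof. by rewrite /half_nested_word take_oversize // size_enum_ord. Qed.

Lemma size_half_nested_word (m k : nat) :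
  k <= m -> size (half_nested_word m k) = m + k.
Proof.
by move=> le_km; rewrite size_cat size_rev size_takel size_enum_ord.
Qed.

Lemma nth_half_nested_word (m k p : nat) (a0 : 'I_m) :
    k <= m -> p < m + k ->
  nth a0 (half_nested_word m k) p = (if p < m then p else m + k - p.+1) :> nat.
Proof.
move=> le_km lt_p; rewrite nth_cat size_enum_ord.
case: ltnP => [lt_pm|le_mp]; first by rewrite nth_enum_ord.
rewrite nth_rev size_takel ?size_enum_ord //; last by lia.
by rewrite nth_take ?nth_enum_ord; lia.
Qed.

(** Used with [o] empty for the subgraph on [2 * k] vertices, and with [o] listing all remaining
    vertices for the bound on lettericity. *)
Lemma isomorphic_half_nested (G : sgraph) (x0 : G) (m k : nat) (u v o : seq G) :
    0 < m -> size u = k -> size v = k -> size (u ++ o) = m ->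
    uniq (u ++ o ++ rev v) ->
    (forall i j, i < j < k ->
      edge (nth x0 u i) (nth x0 u j) = edge (nth x0 u i) (nth x0 v j)
      /\ edge (nth x0 v i) (nth x0 u j) = edge (nth x0 v i) (nth x0 v j)) ->
  exists D, isomorphic (induced [set x in u ++ o ++ rev v])
    (letter_graph D (half_nested_word m k)).
Proof.
move=> m_gt0 sz_u sz_v sz_uo s_uniq uv_edge.
set s := u ++ o ++ rev v in s_uniq *.
have le_km : k <= m by rewrite -sz_uo size_cat sz_u leq_addr.
have sz_s : size s = m + k by rewrite /s catA size_cat sz_uo size_rev sz_v.
have nth_u i : i < k -> nth x0 s i = nth x0 u i.
  by move=> lt_ik; rewrite nth_cat sz_u lt_ik.
have nth_v i : i < k -> nth x0 s (m + k - i.+1) = nth x0 v i.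
  move=> lt_ik; rewrite /s catA nth_cat sz_uo ltnNge.
  have -> /= : m <= m + k - i.+1 by lia.
  rewrite nth_rev sz_v; last by lia.
  by congr nth; lia.
(* An occurrence of [b] after one of [a]: if [a < b] both occurrences of [b] may
   follow, but [uv_edge] makes them equivalent; if [b <= a] only the second can. *)
pose late (a b : nat) := if (a < b) || (k <= b) then b else m + k - b.+1.
pose D := [set c : 'I_m * 'I_m | edge (nth x0 s c.1) (nth x0 s (late c.1 c.2))].
exists D; apply: (isomorphic_letter_graph (x0 := x0) (a0 := Ordinal m_gt0)) => //.
  by rewrite size_half_nested_word.
rewrite sz_s => p q /andP[lt_pq lt_q]; have lt_p := ltn_trans lt_pq lt_q.
rewrite inE /= !nth_half_nested_word // /late.
have [lt_qm|le_mq] := ltnP q m; first by rewrite (ltn_trans lt_pq lt_qm) lt_pq.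
have [j lt_jk q_def] : exists2 j, j < k & q = m + k - j.+1.
  by exists (m + k - q.+1); lia.
have -> : m + k - q.+1 = j by lia.
rewrite q_def (leqNgt k) lt_jk orbF.
(* Position [q] holds [v_j]. If [p < j], the decoder looks at [u_j] instead, which [u_p] does not
   distinguish from [v_j]; if [j <= p], it looks at [v_j] itself. *)
have [lt_pm|le_mp] := ltnP p m.
  case: ifP => // lt_pj; have lt_pk := ltn_trans lt_pj lt_jk.
  by rewrite nth_v // !nth_u //; have [|-> _] := uv_edge p j; rewrite ?lt_pj.
have [i lt_ik p_def] : exists2 i, i < k & p = m + k - i.+1.
  by exists (m + k - p.+1); lia.
(* Letters decrease in the reversed half. The decoder reads the pair [(i, j)] off [u_i] and [v_j],
   while the vertices here are [v_i] and [v_j]; [v_j] does not distinguish [u_i] from [v_i]. *)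
have lt_ji : j < i by lia.
have -> : m + k - p.+1 = i by lia.
rewrite ltnNge (ltnW lt_ji) /= p_def !nth_v // nth_u // edge_sym.
by rewrite [RHS]edge_sym; have [|_ ->] := uv_edge j i; rewrite ?lt_ji.
Qed.

Lemma lettericity_le (G : sgraph) (m : nat) : k_letter m G -> lettericity G <= m.
Proof.
move=> Gm; rewrite /lettericity; case: ex_minnP => l _; apply.
exact/asboolP.
Qed.

Theorem theorem3p2p3 (k : nat) (G : sgraph) (hk : 1 <= k)
    (hG : 2 * (k - 1) + 2 ^ (2 * (k - 1)) + 1 <= #|G|) :
  (exists (S : {set G}) (D : {set 'I_k * 'I_k}),
      #|S| = 2 * k /\ isomorphic (induced S) (letter_graph D (nested_word k)))
  /\ lettericity G <= #|G| - k.
Proof.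
have /card_gt0P[x0 _] : 0 < #|G| by lia.
have [u [v [sz_u sz_v uv_uniq uv_edge]]] := ex_undistinguished_pairs x0 hG.
pose o := enum [predC u ++ v].
have uv_rev : perm_eq (u ++ rev v) (u ++ v) by rewrite perm_cat2l perm_rev.
have uov_perm : perm_eq (u ++ o ++ rev v) ((u ++ v) ++ o).
  by rewrite -catA perm_cat2l perm_sym perm_catC perm_cat2l perm_sym perm_rev.
have uov_uniq : uniq (u ++ o ++ rev v).
  rewrite (perm_uniq uov_perm) cat_uniq uv_uniq enum_uniq andbT.
  by apply/hasPn => x; rewrite mem_enum.
have uov_full x : x \in [set x in u ++ o ++ rev v].
  by rewrite inE (perm_mem uov_perm) mem_cat mem_enum inE; case: (x \in _).
have sz_uov : size (u ++ o) + k = #|G|.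
  rewrite -[RHS]cardsT.
  have -> : [set: G] = [set x in u ++ o ++ rev v] by apply/setP => x; rewrite uov_full inE.
  by rewrite cardsE (card_uniqP uov_uniq) !size_cat size_rev sz_v addnA.
split.
  have [|||D] := @isomorphic_half_nested G x0 k k u v [::] hk sz_u sz_v; rewrite ?cats0 //.
    by rewrite (perm_uniq uv_rev).
  rewrite half_nested_word_diag => iso; exists [set x in u ++ rev v], D; split=> //.
  rewrite cardsE (card_uniqP _) ?(perm_uniq uv_rev) //.
  by rewrite size_cat size_rev sz_u sz_v mul2n addnn.
have m_gt0 : 0 < #|G| - k by rewrite -sz_uov addnK size_cat sz_u ltn_addr.
(* The vertices of [u ++ o] receive distinct letters and those of [v] reuse the letters of [u],
   which saves [k] letters. *)
have [|D iso] := isomorphic_half_nested (o := o) m_gt0 sz_u sz_v _ uov_uniq uv_edge.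
  by rewrite -sz_uov addnK.
apply: lettericity_le.
exists 'I_(#|G| - k), D, (half_nested_word (#|G| - k) k); split; first exact: card_ord.
exact: isomorphic_trans (isomorphic_inducedT uov_full) iso.
Qed.
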